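(* Let $X$ and $Y$ be completely regular topological spaces, let $f:X\times Y\to[-\infty,+\infty]$ be an extended real-valued function and let $K:X\rightrightarrows Y$ be a set-valued mapping with nonempty images. Suppose that: (i) the function $w(x):=\inf_{y\in Kx} f(x,y)$, $x\in X$, is bounded from above on $X$ and is proper as a function with values in $\mathbb{R}\cup\{-\infty\}$ (i.e. it has at least one finite value); (ii) $f$ is continuous on $X\times Y$ as a function into $[-\infty,+\infty]$; (iii) $K$ is both upper semicontinuous and lower semicontinuous in $X$ with (nonempty) compact values; (iv) the set $\mathrm{Gr}(K)=\{(x,y)\in X\times Y: y\in Kx\}$, with the topology inherited from $X\times Y$, contains a dense and completely metrizable subspace. Then the set $$\{u\in C(X\times Y): \text{the supinf problem } \sup_{x\in X}\inf_{y\in Kx}\{f(x,y)+u(x,y)\}\text{ is well-posed}\}$$ contains a dense $G_\delta$-subset of $C(X\times Y)$.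
   Context: Completely regular spaces are understood to be Hausdorff. $X\times Y$ carries the product topology, and $[-\infty,+\infty]$ its usual extended (order) topology. $C(X\times Y)$ is the Banach space of all bounded continuous real-valued functions on $X\times Y$ with the sup norm. For $F:X\times Y\to[-\infty,+\infty]$, consider the supinf problem $\sup_{x\in X}\inf_{y\in Kx}F(x,y)$ and let $v_F$ denote this value. A solution is a pair $(x_0,y_0)\in X\times Y$ with $y_0\in Kx_0$ and $F(x_0,y_0)=\inf_{y\in Kx_0}F(x_0,y)=v_F$. A sequence $\{(x_n,y_n)\}_{n\ge1}\subset X\times Y$ is optimizing for the problem if $y_n\in Kx_n$ for every $n$, $\inf_{y\in Kx_n}F(x_n,y)\to v_F$ and $F(x_n,y_n)\to v_F$. The problem is well-posed if every optimizing sequence converges to some (actually, unique) solution $(x_0,y_0)$ of the problem. A set-valued mapping $\Phi:Z\rightrightarrows T$ with nonempty images between topological spaces is upper semicontinuous at $z_0$ if for every open $V\supset\Phi(z_0)$ there is an open $U\ni z_0$ with $\Phi(z)\subset V$ for all $z\in U$; it is lower semicontinuous at $z_0$ if for every open $V$ with $V\cap\Phi(z_0)\neq\emptyset$ there is an open $U\ni z_0$ with $\Phi(z)\cap V\neq\emptyset$ for all $z\in U$; each property holds in $Z$ if it holds at every point of $Z$. *)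

(* Defs.v *)
From HB Require Import structures.
From mathcomp Require Import all_boot all_order all_algebra.
From mathcomp Require Import all_classical all_reals all_analysis ring lra.

Set Implicit Arguments.
Unset Strict Implicit.
Unset Printing Implicit Defensive.

Import Order.TTheory GRing.Theory Num.Theory.
Import numFieldNormedType.Exports.

Local Open Scope classical_set_scope.
Local Open Scope ring_scope.

Definition bcfun_pred (T : topologicalType) (R : realType) : {pred T -> R^o} :=
  fun u => `[< continuous u /\ bounded_fun u >].

Record bcfun (T : topologicalType) (R : realType) := BCFun {
  bcfun_val :> T -> R^o ;
  bcfun_valP : bcfun_val \in @bcfun_pred T R }.

Section bcfun_normed.
Context (T : topologicalType) (R : realType).
Local Notation C := (bcfun T R).

HB.instance Definition _ := [isSub for @bcfun_val T R].
HB.instance Definition _ := [Choice of C by <:].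

Lemma bcfun_predP (u : T -> R^o) :
  reflect (continuous u /\ exists M : R, forall t, `|u t| <= M)
          (u \in @bcfun_pred T R).
Proof.
apply: (iffP idP) => [/asboolP[cu [M [_ Mu]]]|[cu [M Mu]]].
  by split=> //; exists (M + 1) => t; apply: Mu; rewrite ?ltrDl.
apply/asboolP; split=> //; exists M; split; first exact: num_real.
by move=> N MN t _; exact: le_trans (Mu t) (ltW MN).
Qed.

Lemma bcfun_submod_closed : submod_closed (@bcfun_pred T R).
Proof.
split=> [|a u v /bcfun_predP[cu [M Mu]] /bcfun_predP[cv [N Nv]]].
  apply/bcfun_predP; split; first exact: cst_continuous.
  by exists 0 => t; rewrite normr0.
apply/bcfun_predP; split.
  by move=> t; apply: cvgD; [apply: cvgZr; exact: cu|exact: cv].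
exists (`|a| * M + N) => t; rewrite (le_trans (ler_normD _ _))// lerD//.
by rewrite normrM ler_wpM2l.
Qed.

HB.instance Definition _ := GRing.isSubmodClosed.Build _ _ (@bcfun_pred T R)
  bcfun_submod_closed.
HB.instance Definition _ := [SubChoice_isSubLmodule of C by <:].

(* On an empty domain this is [sup set0 = 0]. *)
Definition sup_norm (u : C) : R := sup (range (fun t => `|u t|)).

Lemma bcfun_continuous (u : C) : continuous u.
Proof. by have /bcfun_predP[] := bcfun_valP u. Qed.

Lemma sup_norm_ub (u : C) t : `|u t| <= sup_norm u.
Proof.
have /bcfun_predP[_ [M Mu]] := bcfun_valP u.
apply: ub_le_sup; last by exists t.
by exists M => _ [s _ <-].
Qed.

Lemma sup_norm_le (u : C) (M : R) :
  0 <= M -> (forall t, `|u t| <= M) -> sup_norm u <= M.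
Proof.
move=> M0 uM; have [ne|e] := pselect (range (fun t => `|u t|) !=set0).
  by apply: ge_sup => // _ [t _ <-].
by move/nonemptyPn : e => e; rewrite /sup_norm e sup0.
Qed.

Lemma sup_norm_ge0 (u : C) : 0 <= sup_norm u.
Proof.
have [[t _]|e] := pselect ([set: T] !=set0).
  by apply: le_trans (sup_norm_ub u t).
by move/nonemptyPn : e => e; rewrite /sup_norm e image_set0 sup0.
Qed.

Lemma sup_normD (u v : C) : sup_norm (u + v) <= sup_norm u + sup_norm v.
Proof.
apply: sup_norm_le => [|t]; first by rewrite addr_ge0// sup_norm_ge0.
by rewrite (le_trans (ler_normD _ _))// lerD// sup_norm_ub.
Qed.

Lemma sup_normZ_le (a : R) (u : C) : sup_norm (a *: u) <= `|a| * sup_norm u.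
Proof.
apply: sup_norm_le => [|t]; first by rewrite mulr_ge0// sup_norm_ge0.
by rewrite normrM ler_wpM2l// sup_norm_ub.
Qed.

Lemma sup_normZ (a : R) (u : C) : sup_norm (a *: u) = `|a| * sup_norm u.
Proof.
apply/eqP; rewrite eq_le sup_normZ_le/=.
have [->|a0] := eqVneq a 0; first by rewrite normr0 mul0r sup_norm_ge0.
rewrite -ler_pdivlMl ?normr_gt0// -normfV.
by rewrite (le_trans _ (sup_normZ_le _ _))// scalerA mulVf// scale1r.
Qed.

Lemma sup_norm0_eq0 (u : C) : sup_norm u = 0 -> u = 0.
Proof.
move=> u0; apply/val_inj/funext => t /=; apply/eqP.
by rewrite -normr_le0 -u0 sup_norm_ub.
Qed.

HB.instance Definition _ :=
  Lmodule_isNormed.Build R C sup_normD sup_normZ sup_norm0_eq0.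

Lemma bcfun_normE (u : C) : `|u| = sup (range (fun t => `|u t|)).
Proof. by []. Qed.

Lemma bcfun_cauchy_cvg (F : set_system C) :
  ProperFilter F -> cauchy F -> cvg F.
Proof.
move=> FF /cauchyP Fc.
have FcE e : 0 < e -> exists2 u : C, F (ball u e) & True.
  by move=> e0; have [u Fu] := Fc e e0; exists u.
have Fb e u : F (ball u e) -> F [set v : C | forall t, `|u t - v t| < e].
  apply: filterS => v; rewrite -ball_normE /= => uv t.
  by apply: le_lt_trans uv; exact: (sup_norm_ub (u - v) t).
have ev t : cvg ((fun u : C => u t : R^o) @ F).
  apply: cauchy_cvg; apply/cauchyP => e e0.
  have [u Fu _] := FcE e e0; exists (u t).
  suff : F [set v : C | ball (u t : R^o) e (v t)] by [].
  by apply: filterS (Fb _ _ Fu) => v /(_ t); rewrite -ball_normE.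
pose g t : R^o := lim ((fun u : C => u t : R^o) @ F).
have close e u : F (ball u e) -> forall t, `|u t - g t| <= e.
  move=> Fu t; apply/ler_addgt0Pr => d d0.
  have Fg : F [set v : C | `|g t - v t| < d] by move/cvgrPdist_lt : (ev t) => /(_ d d0).
  have [v [/= /(_ t) uv gv]] := filter_ex (filterI (Fb _ _ Fu) Fg).
  rewrite -(subrKA (v t)) (le_trans (ler_normD _ _))//.
  by rewrite lerD ?ltW// distrC.
have gP : g \in @bcfun_pred T R.
  apply/bcfun_predP; split; last first.
    have [u Fu _] := FcE 1 ltr01; exists (`|u| + 1) => t.
    rewrite -[g t](subKr (u t)) (le_trans (ler_normB _ _))// lerD//.
      exact: (sup_norm_ub u t).
    exact: close.
  move=> t; apply/cvgrPdist_lt => e e0.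
  have e3 : 0 < e / 4 by rewrite divr_gt0.
  have [u Fu _] := FcE _ e3.
  have /cvgrPdist_lt/(_ _ e3) := @bcfun_continuous u t.
  apply: filterS => s us.
  have -> : g t - g s = (u t - u s) - (u t - g t) + (u s - g s) by ring.
  have gt := close _ _ Fu t; have gs := close _ _ Fu s.
  have := ler_normD (u t - u s - (u t - g t)) (u s - g s).
  have := ler_normB (u t - u s) (u t - g t).
  by move: us gt gs; lra.
apply/cvg_ex; exists (BCFun gP); apply/cvgrPdist_le => e e0.
have [u Fu _] := FcE _ (divr_gt0 e0 (ltr0Sn R 1)).
have hu := close _ _ Fu.
suff : F [set v : C | `|BCFun gP - v| <= e] by [].
apply: filterS (Fb _ _ Fu) => v uv.
apply: sup_norm_le => [|t]; first exact: ltW.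
change (`|g t - v t| <= e); rewrite -(subrKA (u t)) [e]splitr.
rewrite (le_trans (ler_normD _ _))// lerD//; first by rewrite distrC.
exact: ltW.
Qed.

HB.instance Definition _ := Uniform_isComplete.Build C bcfun_cauchy_cvg.

End bcfun_normed.

Section supinf.
Context (R : realType) (X Y : topologicalType).
Implicit Types (F : X * Y -> \bar R) (K : X -> set Y).

Definition inf_over F K (x : X) : \bar R := ereal_inf [set F (x, y) | y in K x].

Definition supinf_value F K : \bar R := ereal_sup (range (inf_over F K)).

Definition supinf_solution F K (p : X * Y) : Prop :=
  [/\ K p.1 p.2, F p = inf_over F K p.1 & inf_over F K p.1 = supinf_value F K].

Definition optimizing F K (s : (X * Y)^nat) : Prop :=
  [/\ forall n, K (s n).1 (s n).2,
      inf_over F K (s n).1 @[n --> \oo] --> supinf_value F K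
    & F (s n) @[n --> \oo] --> supinf_value F K].

Definition well_posed F K : Prop :=
  forall s, optimizing F K s -> exists2 p, supinf_solution F K p & s @ \oo --> p.

End supinf.

Section set_valued.
Context (Z T : topologicalType).
Implicit Types Phi : Z -> set T.

Definition upper_semicontinuous_map Phi : Prop :=
  forall z0 (V : set T), open V -> Phi z0 `<=` V ->
    exists2 U, open_nbhs z0 U & forall z, U z -> Phi z `<=` V.

Definition lower_semicontinuous_map Phi : Prop :=
  forall z0 (V : set T), open V -> V `&` Phi z0 !=set0 ->
    exists2 U, open_nbhs z0 U & forall z, U z -> Phi z `&` V !=set0.

Definition graph Phi : set (Z * T) := [set p | Phi p.1 p.2].

End set_valued.

(* `completely_regular_space` does not include any separation axiom. *)
Definition tychonoff_space (T : topologicalType) : Prop :=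
  completely_regular_space T /\ hausdorff_space T.

(* Completeness is spelled out instead of using `completeType`, whose instances
   are pointed. *)
Definition completely_metrizable (R : realType) (T : topologicalType) : Prop :=
  exists (M : metricType R) (h : T -> M) (g : M -> T),
    [/\ cancel h g, cancel g h, continuous h, continuous g
      & forall F : set_system M, ProperFilter F -> cauchy F -> exists l : M, F --> l].

(* Main.v *)
Require Import Defs.
From mathcomp Require Import all_boot all_order all_algebra.
From mathcomp Require Import all_classical all_reals all_analysis borel_hierarchy.
From mathcomp Require Import ring lra.

(** Call a point of the graph of K e-optimal when its marginal value
    w(x) = inf of F over {x} x Kx and its value F(x, y) are both within e of the
    supinf value v ([near_optimal]); every optimizing sequence is eventually
    e-optimal.  Because K is continuous with compact values, w is continuous
    (Berge), so e-optimality is an open condition.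

    Well-posedness becomes a shrinking condition on the e-optimal sets: if their
    traces on the dense completely metrizable part D of the graph have diameter
    tending to 0, these traces converge to a point p of D.  Regularity of X x Y
    carries the convergence over from D to the e-optimal sets themselves, since D
    is dense and those sets are open; so every optimizing sequence converges to
    p, and p is a solution by continuity of F and upper semicontinuity of w
    ([well_posed_of_shrinking]).

    For r > 0 the perturbations u such that some e-optimal set of f + u has its
    trace on D inside a ball of radius r form a set [concentrated].  It is open,
    because a uniformly small change of the objective costs little in e
    ([near_optimal_perturb]), and it is dense by [localizing_perturbation]: given
    an e-optimal point (x0, y0) in D, adding a bump in x around x0 makes the
    supremum seek x0, and subtracting a lower bump in (x, y) around (x0, y0)
    makes the infimum seek y0.  Baire's theorem in C(X x Y), applied to the radii
    1/(n+1), concludes. *)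

Set Implicit Arguments.
Unset Strict Implicit.
Unset Printing Implicit Defensive.

Import Order.TTheory GRing.Theory Num.Theory.
Import numFieldNormedType.Exports.

Local Open Scope classical_set_scope.
Local Open Scope ring_scope.
Local Open Scope ereal_scope.

(** * Bump functions on completely regular spaces *)

(** Complete regularity is uniformizability, which products preserve. *)
Lemma completely_regular_prod (R : realType) (X Y : topologicalType) :
  completely_regular_space X -> completely_regular_space Y ->
  completely_regular_space (X * Y)%type.
Proof.
move=> cX cY.
pose X' := @completely_regular_uniformity.type R _ cX.
pose Y' := @completely_regular_uniformity.type R _ cY.
exact: (@uniform_completely_regular R (X' * Y')%type).
Qed.

Lemma completely_regular_bump (R : realType) (T : topologicalType) (t : T)
    (V : set T) :
  completely_regular_space T -> nbhs t V ->
  exists b : T -> R, [/\ continuous b, forall s, (0 <= b s <= 1)%R,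
    b t = 1%R & forall s, ~ V s -> b s = 0%R].
Proof.
move=> crT tV.
have clV : closed (~` V°) by apply/open_closedC; exact: open_interior.
have /(uniform_separatorP (R := R))[g [cg g01 g0 g1]] :
  uniform_separator [set t] (~` V°) by apply: crT => //; apply.
exists (fun s => 1 - g s)%R; split.
- by move=> s; apply: cvgB; [exact: cvg_cst|exact: cg].
- move=> s; have : `[0%R, 1%R]%classic (g s) by apply: g01; exists s.
  by rewrite /= in_itv/=; lra.
- by have -> : g t = 0%R; [apply: g0; exists t|rewrite subr0].
- move=> s Vs; have -> : g s = 1%R; last by rewrite subrr.
  by apply: g1; exists s => // /interior_subset.
Qed.

Lemma continuous_open_gt (R : realType) (T : topologicalType)
    (F : T -> \bar R) a : continuous F -> open [set t | a < F t].
Proof. by move=> /continuousP/(_ _ (@open_ereal_gt_ereal _ a)). Qed.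

Lemma continuous_open_lt (R : realType) (T : topologicalType)
    (F : T -> \bar R) a : continuous F -> open [set t | F t < a].
Proof. by move=> /continuousP/(_ _ (@open_ereal_lt_ereal _ a)). Qed.

(** * The marginal function of the infimum *)

Section marginal.
Context (R : realType) (X Y : topologicalType).
Implicit Types (F G : X * Y -> \bar R) (K : X -> set Y).

Lemma inf_over_le F K x y : K x y -> inf_over F K x <= F (x, y).
Proof. by move=> Kxy; apply: ereal_inf_lbound; exists y. Qed.

Lemma inf_over_le_supinf F K x : inf_over F K x <= supinf_value F K.
Proof. by apply: ereal_sup_ubound; exists x. Qed.

Lemma inf_over_le_shift F G K (c : R) x :
  (forall y, K x y -> F (x, y) <= G (x, y) + c%:E) ->
  inf_over F K x <= inf_over G K x + c%:E.
Proof.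
move=> FG; rewrite -leeBlDr//; apply: le_ereal_inf_tmp => _ [y Kxy <-].
by rewrite leeBlDr//; apply: le_trans (FG _ Kxy); exact: inf_over_le.
Qed.

Lemma supinf_value_le_shift F G K (c : R) :
  (forall p, F p <= G p + c%:E) ->
  supinf_value F K <= supinf_value G K + c%:E.
Proof.
move=> FG; apply: ge_ereal_sup => _ [x _ <-].
apply: (@le_trans _ _ (inf_over G K x + c%:E)).
  by apply: inf_over_le_shift => y _; exact: FG.
by rewrite leeD2r// inf_over_le_supinf.
Qed.

(** For a fixed neighbourhood U of x, the points z with U x {z} inside O need not
    form a set containing A in its interior; compactness is used in the
    near-covering form, along the filter of shrinking neighbourhoods U. *)
Lemma tube (A : set Y) (O : set (X * Y)) (x : X) :
  compact A -> open O -> (forall y, A y -> O (x, y)) ->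
  exists U V, [/\ nbhs x U, open V, A `<=` V & U `*` V `<=` O].
Proof.
move=> /compact_near_coveringP cA oO AO.
pose P (U : set X) (y : Y) := nbhs y [set z | forall x', U x' -> O (x', z)].
have P_anti (B C : set X) : B `<=` C -> A `<=` P C -> A `<=` P B.
  move=> BC H y Ay; apply: filterS (H y Ay) => z Cz x' Bx'.
  exact/Cz/BC.
have : \forall U \near powerset_filter_from (nbhs x), A `<=` P U.
  apply: cA => y Ay.
  have /= [[U V] /= [xU yV] UVO] : nbhs (x, y) O.
    by apply: open_nbhs_nbhs; split => //; exact: AO.
  exists (V°, [set U' | U' `<=` U]); first split => /=.
  - exact: nbhs_interior.
  - apply/near_powerset_filter_fromP; last by exists U.
    by move=> B C BC CU; exact: subset_trans CU.
  - move=> [z U'] /= [Vz U'U]; apply: filterS Vz => t Vt x' U'x'.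
    by apply: UVO; split => //=; exact: U'U.
move=> /(near_powerset_filter_fromP _ P_anti)[U xU AU].
exists U, [set z | forall x', U x' -> O (x', z)]°; split => //.
  exact: open_interior.
by move=> [x' z] [/= Ux' /interior_subset]; exact.
Qed.

Context (F : X * Y -> \bar R) (K : X -> set Y).
Hypothesis F_cont : continuous F.

(** Berge: if F > b on {x} x Kx, then F > b on a tube around {x} x Kx, and upper
    semicontinuity of K keeps the nearby values of K inside this tube. *)
Lemma inf_over_lsc : upper_semicontinuous_map K ->
  (forall x, compact (K x)) -> lower_semicontinuous (inf_over F K).
Proof.
move=> uK cK x a aw.
(* The infimum over Kz inherits only a large inequality from the tube; the
   room between a and b makes it strict. *)
have [b [ab bw]] : exists b : R, (a < b)%R /\ b%:E < inf_over F K x.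
  case: (inf_over F K x) aw => [r||]//.
    rewrite lte_fin => ar; exists ((a + r) / 2)%R; rewrite lte_fin; lra.
  by move=> _; exists (a + 1)%R; rewrite ltry; split => //; lra.
have oO : open [set p | b%:E < F p].
  exact: continuous_open_gt.
have [|U [V [xU oV KV UVO]]] := tube (x := x) (cK x) oO.
  by move=> y Kxy /=; apply: lt_le_trans bw _; exact: inf_over_le.
have [U' /open_nbhs_nbhs xU' U'K] := uK x V oV KV.
exists (U `&` U'); first exact: filterI.
move=> z [Uz U'z]; apply: (@lt_le_trans _ _ b%:E); first by rewrite lte_fin.
apply: le_ereal_inf_tmp => _ [y Kzy <-]; apply: ltW.
by apply: (UVO (z, y)); split => //=; exact: (U'K z).
Qed.

(** Berge, the dual half: a point of Kx where F < a can be followed into nearby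
    values of K by lower semicontinuity. *)
Lemma inf_over_usc : lower_semicontinuous_map K ->
  forall a, open [set x | inf_over F K x < a].
Proof.
move=> lK a; rewrite openE => x /= /ereal_inf_lt[_ [y Kxy <-] Fa].
have oO : open [set p | F p < a].
  exact: continuous_open_lt.
have /= [[U V] /= [xU yV] UVO] : nbhs (x, y) [set p | F p < a].
  exact: open_nbhs_nbhs.
have [|W /open_nbhs_nbhs xW WK] := lK x V° (@open_interior _ _).
  by exists y; split => //; exact: nbhs_singleton (nbhs_interior yV).
apply: filterS (filterI xU xW) => z [Uz /WK[y' [Kzy' /interior_subset Vy']]].
apply: (le_lt_trans (inf_over_le F Kzy')).
exact: (UVO (z, y')).
Qed.

End marginal.

(** * Nearly optimal points *)

Section near_optimal.
Context (R : realType) (X Y : topologicalType).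
Implicit Types (F G : X * Y -> \bar R) (K : X -> set Y).

(** On the graph of K, where w(x) <= F(x, y), these two inequalities confine both
    w(x) <= v and F(x, y) to the e-neighbourhood of v.  Membership in the graph
    is left out so that the set is open in the whole product. *)
Definition near_optimal F K (e : R) : set (X * Y) :=
  [set p | supinf_value F K - e%:E < inf_over F K p.1 /\
           F p < supinf_value F K + e%:E].

Lemma near_optimal_mono F K (d e : R) :
  (d <= e)%R -> near_optimal F K d `<=` near_optimal F K e.
Proof.
move=> de p [wp Fp]; split.
  by apply: le_lt_trans wp; rewrite leeB// lee_fin.
by apply: lt_le_trans Fp _; rewrite leeD// lee_fin.
Qed.

(** A change of the objective by at most d moves both the value v and the
    marginal function by at most d, hence the loss of 2 d. *)
Lemma near_optimal_perturb F G K (d e : R) :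
  (forall p, F p <= G p + d%:E) -> (forall p, G p <= F p + d%:E) ->
  near_optimal G K e `<=` near_optimal F K (e + 2 * d).
Proof.
move=> FG GF p [wp Gp].
have vFG := supinf_value_le_shift K FG.
have vGF := supinf_value_le_shift K GF.
have wGF : inf_over G K p.1 <= inf_over F K p.1 + d%:E.
  by apply: inf_over_le_shift => y _; exact: GF.
split.
  rewrite -(lteD2rE _ _ (x := d%:E))//; apply: lt_le_trans wGF.
  apply: le_lt_trans wp.
  rewrite -addeA -!EFinN -EFinD.
  have -> : (- (e + 2 * d) + d)%R = (- e - d)%R by ring.
  have -> : (- e)%:E = d%:E + (- e - d)%:E by rewrite -EFinD; congr EFin; ring.
  by rewrite addeA leeD2r.
apply: le_lt_trans (FG p) _.
rewrite (_ : (e + 2 * d)%R = (d + e + d)%R); last by ring.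
rewrite EFinD addeA lteD2rE// EFinD addeA.
by apply: lt_le_trans Gp _; rewrite leeD2r.
Qed.

Section fixed_problem.
Context (F : X * Y -> \bar R) (K : X -> set Y).
Hypothesis F_cont : continuous F.
Hypothesis K_usc : upper_semicontinuous_map K.
Hypothesis K_lsc : lower_semicontinuous_map K.
Hypothesis K_compact : forall x, compact (K x).
Hypothesis v_fin : supinf_value F K \is a fin_num.

Lemma supinf_value_gtB (e : R) :
  (0 < e)%R -> supinf_value F K - e%:E < supinf_value F K.
Proof. by move=> e0; rewrite lteBlDr// lteDl. Qed.

Lemma near_optimal_open (e : R) : open (near_optimal F K e).
Proof.
apply: openI; last exact: continuous_open_lt.
have /lower_semicontinuousP/(_ (fine (supinf_value F K) - e)%R) :=
  inf_over_lsc F_cont K_usc K_compact.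
rewrite EFinB fineK// => oU.
by apply: (open_comp _ oU) => p _; exact: cvg_fst.
Qed.

Lemma near_optimal_neq0 (e : R) : (0 < e)%R ->
  exists2 p, K p.1 p.2 & near_optimal F K e p.
Proof.
move=> e0; have /ereal_sup_gt[_ [x _ <-] vw] := supinf_value_gtB e0.
have : inf_over F K x < supinf_value F K + e%:E.
  by apply: le_lt_trans (inf_over_le_supinf F K x) _; rewrite lteDl.
by move=> /ereal_inf_lt[_ [y Kxy <-] Fxy]; exists (x, y).
Qed.

Lemma optimizing_near_optimal (s : (X * Y)^nat) (e : R) : (0 < e)%R ->
  optimizing F K s -> \forall n \near \oo, near_optimal F K e (s n).
Proof.
move=> e0 [_ ws Fs].
have A : nbhs (supinf_value F K) [set y | supinf_value F K - e%:E < y].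
  apply: open_nbhs_nbhs; split; first exact: open_ereal_gt_ereal.
  exact: supinf_value_gtB.
have B : nbhs (supinf_value F K) [set y | y < supinf_value F K + e%:E].
  apply: open_nbhs_nbhs; split; first exact: open_ereal_lt_ereal.
  by rewrite /= lteDl.
have {ws}wsA : \forall n \near \oo,
  supinf_value F K - e%:E < inf_over F K (s n).1 := ws _ A.
have {Fs}FsB : \forall n \near \oo, F (s n) < supinf_value F K + e%:E :=
  Fs _ B.
by apply: filterS2 wsA FsB => n.
Qed.

(** A limit of e-optimal points, for every e, satisfies F(p) <= v because F is
    continuous and w(p) >= v because w is upper semicontinuous; as w <= F on the
    graph and w <= v everywhere, all these values agree. *)
Lemma near_optimal_solution (p : X * Y) : K p.1 p.2 ->
  (forall e : R, (0 < e)%R -> closure (near_optimal F K e) p) ->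
  supinf_solution F K p.
Proof.
move=> Kp clp.
have Fp : F p <= supinf_value F K.
  apply/lee_addgt0Pr => e e0; rewrite leNgt; apply/negP => vF.
  have [q [[_ /= Fq] /= vFq]] := clp e e0 _
    (open_nbhs_nbhs (conj (continuous_open_gt _ F_cont) vF)).
  by have := lt_trans Fq vFq; rewrite ltxx.
have wp : supinf_value F K <= inf_over F K p.1.
  apply/lee_addgt0Pr => e e0; rewrite leNgt; apply/negP => wv.
  have wv' : inf_over F K p.1 < supinf_value F K - e%:E by rewrite lteBrDr.
  have oU : open [set q : X * Y | inf_over F K q.1 < supinf_value F K - e%:E].
    have oV := inf_over_usc F_cont K_lsc (supinf_value F K - e%:E).
    by apply: (open_comp _ oV) => q _; exact: cvg_fst.
  have [q [[/= vq _] /= qv]] := clp e e0 _ (open_nbhs_nbhs (conj oU wv')).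
  by have := lt_trans vq qv; rewrite ltxx.
have wF : inf_over F K p.1 <= F p.
  by case: p Kp {clp Fp wp} => x y /=; exact: inf_over_le.
split => //; apply/eqP; rewrite eq_le.
  by rewrite wF andbT (le_trans Fp).
by rewrite wp inf_over_le_supinf.
Qed.

End fixed_problem.
End near_optimal.

(** * Completely metrizable dense parts and the criterion for well-posedness *)

(** The map j is a homeomorphism from a complete metric space onto a dense part
    of S; continuity of the inverse is expressed in the last clause. *)
Definition complete_parametrization (R : realType) (M : metricType R)
    (Z : topologicalType) (S : set Z) (j : M -> Z) : Prop :=
  [/\ forall A : set_system M, ProperFilter A -> cauchy A ->
        exists l : M, A --> l,
      continuous j, forall m, S (j m),
      forall O : set Z, open O -> O `&` S !=set0 -> exists m, O (j m)
    & forall m (r : R), (0 < r)%R ->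
        nbhs (j m) [set z | forall m', j m' = z -> ball m r m']].

Lemma complete_parametrization_of_dense (R : realType) (Z : topologicalType)
    (S : set Z) (D : set S) :
  dense D -> completely_metrizable R D ->
  exists (M : metricType R) (j : M -> Z), complete_parametrization S j.
Proof.
move=> dD [M [h [g [hK gK ch cg M_complete]]]].
pose i (d : D) : Z := set_val (set_val d : S).
have ci : continuous i.
  move=> d; apply: (@continuous_comp D S Z set_val set_val d).
    exact: initial_continuous.
  exact: initial_continuous.
exists M, (i \o g); split => //.
- by move=> m; apply: continuous_comp; [exact: cg|exact: ci].
- by move=> m; exact: set_valP.
- move=> O oO [z [Oz Sz]].
  have oO' : open (set_val @^-1` O : set S) by exists O.
  have [|s [Os Ds]] := dD _ _ oO'.
    by exists (SigSub (mem_set Sz)).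
  exists (h (SigSub (mem_set Ds))).
  by rewrite /= hK.
- move=> m r r0.
  have /= : nbhs (g m) [set d | ball m r (h d)].
    by apply: (ch (g m)); rewrite gK; exact: nbhsx_ballx.
  move=> [_ [[V [W oW <-] <-] Wm WB]].
  apply: (@filterS _ _ _ W) => [z Wz m' m'z|]; last exact: open_nbhs_nbhs.
  by rewrite -[m']gK; apply: WB; move: Wz; rewrite -m'z.
Qed.

Section criterion.
Context (R : realType) (X Y : topologicalType) (M : metricType R).
Context (F : X * Y -> \bar R) (K : X -> set Y) (j : M -> X * Y).
Hypothesis XY_creg : completely_regular_space (X * Y)%type.
Hypothesis F_cont : continuous F.
Hypothesis K_usc : upper_semicontinuous_map K.
Hypothesis K_lsc : lower_semicontinuous_map K.
Hypothesis K_compact : forall x, compact (K x).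
Hypothesis v_fin : supinf_value F K \is a fin_num.
Hypothesis j_param : complete_parametrization (graph K) j.

(** The traces j^-1(e-optimal set) are a base of a Cauchy filter, whose limit is
    the solution. *)
Lemma well_posed_of_shrinking :
  (forall r : R, (0 < r)%R -> exists2 e : R, (0 < e)%R &
     exists m, j @^-1` near_optimal F K e `<=` ball m r) ->
  well_posed F K.
Proof.
move=> shr; have [M_complete cj jK jd _] := j_param.
pose B (e : R) := j @^-1` near_optimal F K e.
pose A := filter_from [set e : R | (0 < e)%R] B.
have no_open e := near_optimal_open F_cont K_usc K_compact v_fin e.
have A_proper : ProperFilter A.
  apply: filter_from_proper.
    apply: filter_from_filter; first by exists 1%R => /=.
    move=> d e d0 e0; exists (Num.min d e); first by rewrite /= lt_min d0.
    by move=> m Bm; split; apply: near_optimal_mono Bm; rewrite ge_min lexx ?orbT.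
  move=> e e0; apply: jd; first exact: no_open.
  by have [p Kp np] := near_optimal_neq0 v_fin e0; exists p.
have A_cauchy : cauchy A.
  apply/cauchy_exP => r r0; have [e e0 [m Bm]] := shr r r0.
  by exists m; exists e.
have [l Al] := M_complete A _ A_cauchy.
have jAl : j @ A --> j l by apply: cvg_trans (cj l); exact: cvg_app.
have l_sol : supinf_solution F K (j l).
  apply: near_optimal_solution => // [|e e0 V jlV]; first exact: jK.
  have /filter_ex[m [Vm Bm]] : A ((j @^-1` V) `&` B e).
    by apply: filterI; [exact: jAl|exists e].
  by exists (j m).
move=> s s_opt; exists (j l) => // V jlV.
have [b [cb b01 bl bV]] := completely_regular_bump R XY_creg jlV.
have [e e0 Be] : A (j @^-1` [set p | (1 / 2 < b p)%R]).
  apply: jAl; apply: open_nbhs_nbhs; split => /=; last by rewrite bl; lra.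
  by move/continuousP : cb => /(_ _ (@open_gt R (1 / 2)%R)).
(* An e-optimal point of the graph outside V would lie in an open set, where the
   bump is below 1/2, which meets the dense part: there the bump exceeds 1/2. *)
have noV p : K p.1 p.2 -> near_optimal F K e p -> V p.
  move=> Kp np; apply: contrapT => Vp.
  have oO : open (near_optimal F K e `&` [set p | (b p < 1 / 2)%R]).
    apply: openI; first exact: no_open.
    by move/continuousP : cb => /(_ _ (@open_lt R (1 / 2)%R)).
  have [|m [nm /= bm]] := jd _ oO.
    by exists p; split => //; split => //=; rewrite bV//; lra.
  by have := Be m nm; rewrite /=; lra.
have [sK _ _] := s_opt.
have := optimizing_near_optimal v_fin e0 s_opt.
by apply: filterS => n; exact: noV.
Qed.

End criterion.

(** * Localizing the nearly optimal points by a small perturbation *)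

Section perturbation.
Context (R : realType) (X Y : topologicalType).
Implicit Types (F : X * Y -> \bar R) (K : X -> set Y).

Lemma continuous_addEFin (T : topologicalType) (F : T -> \bar R) (g : T -> R) :
  continuous F -> continuous g -> continuous (fun t => F t + (g t)%:E).
Proof.
move=> cF cg t; apply: cvgeD; [exact: fin_num_adde_defl|exact: cF|].
by apply: cvg_EFin; [exact: nearW|exact: cg].
Qed.

Lemma bcfun_normr_le (T : topologicalType) (u : bcfun T R) t :
  (`|u t| <= `|u|)%R.
Proof. exact: sup_norm_ub. Qed.

Lemma supinf_value_fin_num F K (u : bcfun (X * Y)%type R) :
  supinf_value F K \is a fin_num ->
  supinf_value (fun p => F p + (u p)%:E) K \is a fin_num.
Proof.
move=> vF; set G := fun p => _.
have GF : supinf_value G K <= supinf_value F K + (`|u|%R)%:E.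
  apply: supinf_value_le_shift => p; rewrite leeD2l// lee_fin.
  by rewrite (le_trans (ler_norm _))// bcfun_normr_le.
have FG : supinf_value F K <= supinf_value G K + (`|u|%R)%:E.
  apply: supinf_value_le_shift => p; rewrite /G -addeA -EFinD -[leLHS]adde0.
  rewrite leeD2l// lee_fin -lerBlDr sub0r lerNl.
  by rewrite (le_trans (ler_norm _))// normrN bcfun_normr_le.
move: vF GF FG; case: (supinf_value F K) => [v||]//.
by case: (supinf_value G K).
Qed.

(** With z = (x0, y0) e-optimal, the perturbation is h = 10 e a(x) - 4 e b(x, y),
    where b is a bump at z supported in W.  Subtracting 4 e b makes the marginal
    function near x0 drop by more than 2 e below its former values, so points
    over such x that are optimal up to 2 e must feel b, that is, lie in W.  The
    bump a, supported in the set U of these x, raises the value at x0 by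
    at least 10 e - 4 e, so that nearly optimal points have x in U. *)
Lemma localizing_perturbation F K (z : X * Y) (W : set (X * Y)) (e : R) :
  completely_regular_space X -> completely_regular_space (X * Y)%type ->
  continuous F -> upper_semicontinuous_map K -> lower_semicontinuous_map K ->
  (forall x, compact (K x)) -> supinf_value F K \is a fin_num ->
  (0 < e)%R -> K z.1 z.2 -> near_optimal F K e z -> nbhs z W ->
  exists h : bcfun (X * Y)%type R, (`|h| <= 10 * e)%R /\
    forall p, K p.1 p.2 ->
      near_optimal (fun q => F q + (h q)%:E) K e p -> W p.
Proof.
move=> crX crXY cF uK lK cK v_fin e0.
case: z => x0 y0 /= Kz [/= wz Fz] zW.
have [b [cb b01 bz bW]] := completely_regular_bump R crXY zW.
move: wz Fz; rewrite -(fineK v_fin); set r := fine _ => wz Fz.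
pose F1 p := F p + (- (4 * e * b p))%:E.
have cF1 : continuous F1.
  apply: continuous_addEFin => // p; apply: cvgN; apply: cvgM; last exact: cb.
  exact: cvg_cst.
have w1z : inf_over F1 K x0 < (r - 3 * e)%:E.
  apply: le_lt_trans (inf_over_le F1 Kz) _.
  rewrite /F1 bz (_ : (r - 3 * e)%R = (r + e + - (4 * e * 1))%R); last by ring.
  by rewrite (EFinD (r + e)) lteD2rE.
(* On U, replacing F by F1 lowers the marginal function from above r - e to below
   r - 3 e. *)
pose U := [set x | inf_over F1 K x < (r - 3 * e)%:E] `&`
          [set x | (r - e)%:E < inf_over F K x].
have x0U : nbhs x0 U.
  apply: open_nbhs_nbhs; split => //; apply: openI; first exact: inf_over_usc.
  by have /lower_semicontinuousP := inf_over_lsc cF uK cK; exact.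
have [a [ca a01 ax0 aU]] := completely_regular_bump R crX x0U.
pose g (p : X * Y) : R^o := (10 * e * a p.1 - 4 * e * b p)%R.
have ea x : (0 <= e * a x <= e)%R.
  by have /andP[a0 a1] := a01 x; rewrite mulr_ge0 ?ler_piMr// ltW.
have eb p : (0 <= e * b p <= e)%R.
  by have /andP[b0 b1] := b01 p; rewrite mulr_ge0 ?ler_piMr// ltW.
have g_bound p : (`|g p| <= 10 * e)%R.
  by rewrite ler_norml /g -!mulrA; have := ea p.1; have := eb p; lra.
have gP : g \in @bcfun_pred (X * Y)%type R.
  apply/bcfun_predP; split; last by exists (10 * e)%R.
  move=> p; apply: cvgB; apply: cvgM; try exact: cvg_cst; last exact: cb.
  by apply: cvg_comp; [exact: cvg_fst|exact: ca].
exists (BCFun gP); split.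
  by apply: sup_norm_le => //; rewrite mulr_ge0// ltW.
set F2 := fun q => _ + _.
have w2_le x : inf_over F2 K x <= inf_over F1 K x + (10 * e * a x)%:E.
  apply: inf_over_le_shift => y _; rewrite /F2 /F1 /= -addeA -EFinD /g /=.
  by rewrite (addrC (- _)%R).
have w2_out x : ~ U x -> inf_over F2 K x <= r%:E.
  move=> Ux; apply: (@le_trans _ _ (inf_over F K x + 0%:E)).
    apply: inf_over_le_shift => y _; rewrite leeD2l// lee_fin /g/= aU// -mulrA.
    by have := eb (x, y); lra.
  by rewrite adde0 (le_trans (inf_over_le_supinf _ _ _))// fineK.
have v2_gt : (r + 5 * e)%:E < supinf_value F2 K.
  apply: lt_le_trans (inf_over_le_supinf F2 K x0).
  rewrite -(lteD2rE _ _ (x := (- (6 * e))%:E))// -EFinD.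
  rewrite (_ : (r + 5 * e + - (6 * e))%R = (r - e)%R); last by ring.
  apply: lt_le_trans wz _; apply: inf_over_le_shift => y _.
  rewrite /F2 /= -addeA -EFinD -[leLHS]adde0 leeD2l// lee_fin /g /= ax0.
  by rewrite -!mulrA; have := eb (x0, y); lra.
case=> x y /= Kxy [/= w2 F2xy].
have w2_gt : (r + 4 * e)%:E < inf_over F2 K x.
  apply: le_lt_trans w2.
  rewrite (_ : (r + 4 * e)%R = (r + 5 * e + - e)%R); last by ring.
  by rewrite EFinD leeD2r// ltW.
have [w1x wx] : U x.
  apply: contrapT => /w2_out w2r; have := lt_le_trans w2_gt w2r.
  by rewrite lte_fin; lra.
apply: contrapT => nW.
have F2w2 : F2 (x, y) < inf_over F2 K x + (2 * e)%:E.
  apply: lt_trans F2xy _; move: w2; rewrite -(lteD2rE _ _ (x := (2 * e)%:E))//.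
  by rewrite -addeA -EFinD (_ : (- e + 2 * e)%R = e)//; ring.
have : F (x, y) + (10 * e * a x)%:E <
    inf_over F1 K x + (2 * e)%:E + (10 * e * a x)%:E.
  have -> : F (x, y) + (10 * e * a x)%:E = F2 (x, y).
    by rewrite /F2 /= /g /= (bW (x, y))// mulr0 subr0.
  by apply: lt_le_trans F2w2 _; rewrite addeAC leeD2r.
rewrite lteD2rE// => Fw1.
have := lt_le_trans wx (inf_over_le F Kxy).
move=> /lt_trans /(_ Fw1).
have : inf_over F1 K x + (2 * e)%:E < (r - e)%:E.
  rewrite (_ : (r - e)%R = (r - 3 * e + 2 * e)%R); last by ring.
  by rewrite (EFinD (r - 3 * e)) lteD2rE.
by move=> /lt_trans H /H; rewrite ltxx.
Qed.

End perturbation.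

(** * Genericity of well-posedness *)

Section generic.
Context (R : realType) (X Y : topologicalType) (M : metricType R).
Context (f : X * Y -> \bar R) (K : X -> set Y) (j : M -> X * Y).
Hypothesis X_creg : completely_regular_space X.
Hypothesis XY_creg : completely_regular_space (X * Y)%type.
Hypothesis f_cont : continuous f.
Hypothesis K_usc : upper_semicontinuous_map K.
Hypothesis K_lsc : lower_semicontinuous_map K.
Hypothesis K_compact : forall x, compact (K x).
Hypothesis v_fin : supinf_value f K \is a fin_num.
Hypothesis j_param : complete_parametrization (graph K) j.

Local Notation C := (bcfun (X * Y)%type R).
Local Notation perturbed u := (fun p => f p + (u p)%:E).

Definition concentrated (r : R) : set C :=
  [set u | exists2 e : R, (0 < e)%R & exists m,
     j @^-1` near_optimal (perturbed u) K e `<=` ball m r].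

Lemma concentrated_open r : open (concentrated r).
Proof.
rewrite openE => u [e e0 [m um]].
have e4 : (0 < e / 4)%R by rewrite divr_gt0.
apply/nbhs_ballP; exists (e / 4)%R => //= u'; rewrite -ball_normE /= => uu'.
exists (e / 2)%R; first by rewrite divr_gt0.
exists m => m' nm'; apply: um.
rewrite /= (_ : e = e / 2 + 2 * (e / 4))%R; last by field.
have uu'_le p : (`|u p - u' p| <= e / 4)%R.
  by apply: le_trans (ltW uu'); exact: (bcfun_normr_le (u - u')%R p).
apply: near_optimal_perturb nm' => p; rewrite -addeA -EFinD leeD2l// lee_fin.
  by have := uu'_le p; rewrite ler_norml; lra.
by have := uu'_le p; rewrite ler_norml; lra.
Qed.

(** Density of the parametrized part provides an e-optimal point of the form
    j m, and the inverse of j being continuous there, a neighbourhood W of j m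
    whose trace lies in the ball of radius r; the perturbation then confines the
    e-optimal points to W. *)
Lemma concentrated_dense r : (0 < r)%R -> dense (concentrated r).
Proof.
move=> r0 O [u Ou] oO.
have [_ _ jK jd jball] := j_param.
have /nbhs_ballP[d /= d0 dO] : nbhs u O by exact: open_nbhs_nbhs.
(* The perturbation has norm at most 10 e = d / 2 < d. *)
pose e := (d / 20)%R; have e0 : (0 < e)%R by rewrite divr_gt0.
have cF : continuous (perturbed u).
  by apply: continuous_addEFin => //; exact: bcfun_continuous.
have vF := supinf_value_fin_num u v_fin.
have [|m nm] := jd _ (near_optimal_open (e := e) cF K_usc K_compact vF).
  have [p Kp np] := near_optimal_neq0 vF e0.
  by exists p.
have [h [h_le hW]] := localizing_perturbation
  X_creg XY_creg cF K_usc K_lsc K_compact vF e0 (jK m) nm (jball m r r0).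
exists (u + h)%R; split.
  apply: dO; rewrite -ball_normE /= opprD addrA subrr sub0r normrN.
  by apply: le_lt_trans h_le _; rewrite /e; lra.
exists e => //; exists m => m' nm'.
apply: (hW (j m')) => //; first exact: jK.
rewrite (_ : (fun q => _) = perturbed (u + h)%R)//.
by apply/funext => q; rewrite EFinD addeA.
Qed.

Lemma concentrated_well_posed :
  \bigcap_n concentrated n.+1%:R^-1 `<=` [set u | well_posed (perturbed u) K].
Proof.
move=> u cu; apply: (well_posed_of_shrinking (j := j)) => //.
- by apply: continuous_addEFin => //; exact: bcfun_continuous.
- exact: supinf_value_fin_num.
- move=> r r0; have [n nr] : exists n, (n.+1%:R^-1 < r)%R.
    by have /filter_ex[n nr] := near_infty_natSinv_lt (PosNum r0); exists n.
  have [e e0 [m em]] := cu n I; exists e => //; exists m.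
  by apply: subset_trans em _; apply: le_ball; exact: ltW.
Qed.

End generic.

Theorem theorem3p4 (R : realType) (X Y : topologicalType)
    (f : X * Y -> \bar R) (K : X -> set Y)
    (tychX : tychonoff_space X) (tychY : tychonoff_space Y)
    (K_neq0 : forall x, K x !=set0)
    (w_ub : exists M : R, forall x, inf_over f K x <= M%:E)
    (w_proper : exists x, inf_over f K x \is a fin_num)
    (f_cont : continuous f)
    (K_usc : upper_semicontinuous_map K)
    (K_lsc : lower_semicontinuous_map K)
    (K_compact : forall x, compact (K x))
    (GrK : exists2 D : set (graph K), dense D & completely_metrizable R D) :
  exists G : set (bcfun (X * Y)%type R),
    [/\ Gdelta G, dense G
      & G `<=` [set u : bcfun (X * Y)%type R |
                 well_posed (fun p => f p + (u p)%:E) K]].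
Proof.
have [crX _] := tychX; have [crY _] := tychY.
have crXY := completely_regular_prod R crX crY.
have v_fin : supinf_value f K \is a fin_num.
  have [B wB] := w_ub; have [x wx] := w_proper.
  have vB : supinf_value f K <= B%:E by apply: ge_ereal_sup => _ [z _ <-].
  move: wx (inf_over_le_supinf f K x) vB.
  by case: (inf_over f K x) => // w _; case: (supinf_value f K).
have [D dD cmD] := GrK.
have [M [j j_param]] := complete_parametrization_of_dense dD cmD.
have r0 n : (0 < n.+1%:R^-1 :> R)%R by rewrite invr_gt0.
pose G n := concentrated f K j n.+1%:R^-1.
have G_open n : open (G n) by exact: concentrated_open.
have G_dense n : dense (G n).
  exact: (concentrated_dense crX crXY f_cont K_usc K_lsc K_compact v_fin
    j_param (r0 n)).
exists (\bigcap_n G n); split; first by exists G.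
  apply: Baire => n; split; [exact: G_open|exact: G_dense].
exact: concentrated_well_posed.
Qed.
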